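(* Let $\mathcal{A}\in\mathbb{C}^{\mathbf{I}(N)\times\mathbf{I}(N)}$ be a tensor with $\mathrm{ind}(\mathcal{A})=k$. Then $$\mathcal{A}^{D}=\mathcal{A}^{k}*_N(\mathcal{A}^{2k+1})^{\dagger}*_N\mathcal{A}^{k}.$$
   Context: For positive integers $I_1,\dots,I_N$ write $\mathbf{I}(N)=I_1\times\cdots\times I_N$; $\mathbb{C}^{\mathbf{I}(N)\times\mathbf{J}(N)}$ is the set of complex tensors with entries $a_{i_1\dots i_N j_1\dots j_N}$, $1\le i_s\le I_s$, $1\le j_s\le J_s$. The Einstein product of $\mathcal{A}\in\mathbb{C}^{\mathbf{I}(N)\times\mathbf{K}(N)}$ and $\mathcal{B}\in\mathbb{C}^{\mathbf{K}(N)\times\mathbf{J}(N)}$ is $(\mathcal{A}*_N\mathcal{B})_{i_1\dots i_N j_1\dots j_N}=\sum_{k_1,\dots,k_N}a_{i_1\dots i_N k_1\dots k_N}b_{k_1\dots k_N j_1\dots j_N}$; similarly $\mathcal{A}*_N\mathcal{X}\in\mathbb{C}^{\mathbf{I}(N)}$ for $\mathcal{X}\in\mathbb{C}^{\mathbf{K}(N)}$. Powers of $\mathcal{A}\in\mathbb{C}^{\mathbf{I}(N)\times\mathbf{I}(N)}$ are taken with $*_N$, and $\mathcal{A}^0=\mathcal{I}$ is the identity tensor. The range of $\mathcal{A}$ is $\mathfrak{R}(\mathcal{A})=\{\mathcal{A}*_N\mathcal{X}:\mathcal{X}\in\mathbb{C}^{\mathbf{I}(N)}\}$. The index $\mathrm{ind}(\mathcal{A})$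 is the smallest nonnegative integer $k$ with $\mathfrak{R}(\mathcal{A}^k)=\mathfrak{R}(\mathcal{A}^{k+1})$. The Drazin inverse $\mathcal{A}^D$ of $\mathcal{A}$ with $\mathrm{ind}(\mathcal{A})=k$ is the (unique, always existing) tensor $\mathcal{X}\in\mathbb{C}^{\mathbf{I}(N)\times\mathbf{I}(N)}$ with $\mathcal{A}^{k+1}*_N\mathcal{X}=\mathcal{A}^k$, $\mathcal{X}*_N\mathcal{A}*_N\mathcal{X}=\mathcal{X}$, $\mathcal{A}*_N\mathcal{X}=\mathcal{X}*_N\mathcal{A}$. The conjugate transpose is $(\mathcal{A}^* )_{i_1\dots i_Nj_1\dots j_N}=\overline{a_{j_1\dots j_Ni_1\dots i_N}}$. The Moore-Penrose inverse $\mathcal{A}^\dagger$ is the unique $\mathcal{X}$ with $\mathcal{A}*_N\mathcal{X}*_N\mathcal{A}=\mathcal{A}$, $\mathcal{X}*_N\mathcal{A}*_N\mathcal{X}=\mathcal{X}$, $(\mathcal{A}*_N\mathcal{X})^*=\mathcal{A}*_N\mathcal{X}$, $(\mathcal{X}*_N\mathcal{A})^*=\mathcal{X}*_N\mathcal{A}$. *)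

(* Defs.v *)
From HB Require Import structures.
From mathcomp Require Import all_boot all_order all_algebra.
From mathcomp Require Import boolp classical_sets reals.
From mathcomp Require Import complex.

Set Implicit Arguments.
Unset Strict Implicit.
Unset Printing Implicit Defensive.
Import Order.TTheory GRing.Theory Num.Theory.
Local Open Scope ring_scope.

(* The tuples (i_1, ..., i_N) with i_s ranging over I_s values. *)
Definition midx (N : nat) (I : 'I_N -> nat) : Type :=
  {dffun forall s : 'I_N, 'I_(I s)}.

HB.instance Definition _ (N : nat) (I : 'I_N -> nat) :=
  Finite.on (midx I).

(* C^{I(N) x J(N)}; any realType R is a copy of the reals, so R[i] is C. *)
Definition tensor (R : realType) (N : nat) (I J : 'I_N -> nat) : Type :=
  {ffun midx I * midx J -> R[i]}.

HB.instance Definition _ (R : realType) (N : nat) (I J : 'I_N -> nat) :=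
  GRing.Zmodule.on (tensor R I J).

(* C^{I(N)} *)
Definition tvec (R : realType) (N : nat) (I : 'I_N -> nat) : Type :=
  {ffun midx I -> R[i]}.

Definition einstein (R : realType) (N : nat) (I K J : 'I_N -> nat)
    (A : tensor R I K) (B : tensor R K J) : tensor R I J :=
  [ffun ij => \sum_(k : midx K) A (ij.1, k) * B (k, ij.2)].

Notation "A *e B" := (einstein A B) (at level 40, left associativity).

Definition tapply (R : realType) (N : nat) (I K : 'I_N -> nat)
    (A : tensor R I K) (X : tvec R K) : tvec R I :=
  [ffun i => \sum_(k : midx K) A (i, k) * X k].

Definition tid (R : realType) (N : nat) (I : 'I_N -> nat) : tensor R I I :=
  [ffun ij => (ij.1 == ij.2)%:R].

Definition tpow (R : realType) (N : nat) (I : 'I_N -> nat)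
    (A : tensor R I I) (n : nat) : tensor R I I :=
  iter n (einstein A) (tid R I).

Definition tctr (R : realType) (N : nat) (I J : 'I_N -> nat)
    (A : tensor R I J) : tensor R J I :=
  [ffun ji => (A (ji.2, ji.1))^*].

Definition trange (R : realType) (N : nat) (I K : 'I_N -> nat)
    (A : tensor R I K) : set (tvec R I) :=
  range (tapply A).

Section IndexExists.
Variables (R : realType) (N : nat) (I : 'I_N -> nat).
Implicit Types A : tensor R I I.

Lemma tapply_is_linear A :
  linear (tapply A : {ffun midx I -> (R[i])^o} -> {ffun midx I -> (R[i])^o}).
Proof.
move=> a u v; apply/ffunP => i; rewrite !ffunE scaler_sumr -big_split /=.
by apply: eq_bigr => k _; rewrite !ffunE mulrDr /GRing.scale /= mulrCA.
Qed.

Lemma tapply_einstein A (B : tensor R I I) X :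
  tapply (A *e B) X = tapply A (tapply B X).
Proof.
apply/ffunP => i; rewrite !ffunE.
under eq_bigr => k _ do rewrite ffunE mulr_suml.
rewrite exchange_big /=; apply: eq_bigr => j _.
by rewrite ffunE mulr_sumr; apply: eq_bigr => k _; rewrite mulrA.
Qed.

Lemma tapply_tid X : tapply (tid R I) X = X.
Proof.
apply/ffunP => i; rewrite !ffunE (bigD1 i) //= ffunE eqxx mul1r big1 ?addr0 //.
by move=> k; rewrite ffunE /= eq_sym => /negPf ->; rewrite mul0r.
Qed.

Lemma tapply_tpow A n X : tapply (tpow A n) X = iter n (tapply A) X.
Proof.
by elim: n => [|n IH]; rewrite ?tapply_tid //= tapply_einstein IH.
Qed.

Lemma trange_tpow A n Y :
  trange (tpow A n) Y <-> exists X, Y = iter n (tapply A) X.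
Proof.
split=> [[X _ <-]|[X ->]]; first by exists X; rewrite tapply_tpow.
by exists X => //; rewrite tapply_tpow.
Qed.

Lemma tindex_subproof A :
  exists k, `[< trange (tpow A k) = trange (tpow A k.+1) >].
Proof.
pose V := {ffun midx I -> (R[i])^o}.
pose L := GRing.isLinear.Build _ V V *:%R (tapply A) (tapply_is_linear A).
pose fA : {linear V -> V} := HB.pack (tapply A : V -> V) L.
pose f : 'End(V) := linfun fA.
pose W n : {vspace V} := iter n (lfun_img f) fullv.
have WP n (Y : V) : reflect (exists X, Y = iter n (tapply A) X) (Y \in W n).
  elim: n Y => [|n IH] Y /=; first by rewrite memvf; left; exists Y.
  apply: (iffP idP) => [/memv_imgP[Z /IH[X ->] ->]|[X ->]].
    by exists X; rewrite lfunE.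
  by apply/memv_imgP; exists (iter n (tapply A) X);
    [apply/IH; exists X | rewrite lfunE].
have subW n : (W n.+1 <= W n)%VS.
  by elim: n => [|n IH]; [exact: subvf | exact: limgS].
have [k eqk] : exists k, W k.+1 = W k.
  apply: contrapT => /forallNP neqW.
  have ltW n : (\dim (W n.+1) < \dim (W n))%N.
    rewrite ltnNge; apply/negP => leW.
    by apply: (neqW n); apply/eqP; rewrite eqEdim subW.
  have leW n : (\dim (W n) + n <= \dim (W 0))%N.
    elim: n => [|n IH]; first by rewrite addn0.
    by rewrite addnS (leq_trans _ IH) // ltn_add2r.
  have := leq_trans (leq_addl _ _) (leW (\dim (W 0)).+1).
  by rewrite ltnn.
exists k; apply/asboolP/seteqP; split=> Y /trange_tpow/WP.
  by rewrite -eqk => /WP/trange_tpow.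
by rewrite eqk => /WP/trange_tpow.
Qed.

End IndexExists.

Definition tindex (R : realType) (N : nat) (I : 'I_N -> nat)
    (A : tensor R I I) : nat :=
  ex_minn (tindex_subproof A).

Definition is_drazin (R : realType) (N : nat) (I : 'I_N -> nat)
    (A X : tensor R I I) : Prop :=
  [/\ tpow A (tindex A).+1 *e X = tpow A (tindex A),
      X *e A *e X = X
    & A *e X = X *e A].

Definition is_mp (R : realType) (N : nat) (I J : 'I_N -> nat)
    (A : tensor R I J) (X : tensor R J I) : Prop :=
  [/\ A *e X *e A = A,
      X *e A *e X = X,
      tctr (A *e X) = A *e X
    & tctr (X *e A) = X *e A].

(* Both inverses always exist and are unique, so the default value 0 given to
   xget is never returned. *)
Definition drazin (R : realType) (N : nat) (I : 'I_N -> nat)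
    (A : tensor R I I) : tensor R I I :=
  xget 0 [set X | is_drazin A X].

Definition mpinv (R : realType) (N : nat) (I J : 'I_N -> nat)
    (A : tensor R I J) : tensor R J I :=
  xget 0 [set X | is_mp A X].

(* Main.v *)
(* The Moore-Penrose inverse enters only through B G B = B, for
   B = A^(2k+1): every such G satisfies A^D = A^k G A^k.  Indeed, stability of
   the ranges gives A^k = B W, and comparing ranks then gives A^k = V B, so
   X = A^k G A^k equals both A^k W and V A^k, whence the Drazin equations.  The
   default value in the definition of mpinv is excluded by Zlobec's formula
   A^* G A^*, where G is a reflexive generalized inverse of A^* A A^*. *)
Require Import Defs.
From mathcomp Require Import all_boot all_order all_algebra.
From mathcomp Require Import boolp classical_sets reals.
From mathcomp Require Import complex.

Set Implicit Arguments.
Unset Strict Implicit.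
Unset Printing Implicit Defensive.
Import Order.TTheory GRing.Theory Num.Theory.
Local Open Scope ring_scope.

Section EinsteinProduct.
Variables (R : realType) (N : nat).
Implicit Types I J K L : 'I_N -> nat.

Lemma einsteinA I J K L (A : tensor R I J) (B : tensor R J K)
    (C : tensor R K L) : A *e (B *e C) = A *e B *e C.
Proof.
apply/ffunP => -[i l]; rewrite !ffunE /=.
under eq_bigr => j _ do rewrite ffunE mulr_sumr /=.
rewrite exchange_big /=; apply: eq_bigr => k _.
by rewrite ffunE mulr_suml; apply: eq_bigr => j _; rewrite mulrA.
Qed.

Lemma einstein1t I J (A : tensor R I J) : tid R I *e A = A.
Proof.
apply/ffunP => -[i j]; rewrite !ffunE /= (bigD1 i) //= ffunE eqxx mul1r.
rewrite big1 ?addr0 // => k.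
by rewrite ffunE /= eq_sym => /negPf ->; rewrite mul0r.
Qed.

Lemma einsteint1 I J (A : tensor R I J) : A *e tid R J = A.
Proof.
apply/ffunP => -[i j]; rewrite !ffunE /= (bigD1 j) //= ffunE eqxx mulr1.
by rewrite big1 ?addr0 // => k; rewrite ffunE /= => /negPf ->; rewrite mulr0.
Qed.

Lemma einsteinBr I J K (A : tensor R I J) (B C : tensor R J K) :
  A *e (B - C) = A *e B - A *e C.
Proof.
apply/ffunP => -[i k]; rewrite !ffunE -sumrB /=.
by apply: eq_bigr => j _; rewrite !ffunE mulrBr.
Qed.

Lemma tctrK I J (A : tensor R I J) : tctr (tctr A) = A.
Proof. by apply/ffunP => -[i j]; rewrite !ffunE /= conjCK. Qed.

Lemma tctrM I J K (A : tensor R I J) (B : tensor R J K) :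
  tctr (A *e B) = tctr B *e tctr A.
Proof.
apply/ffunP => -[k i]; rewrite !ffunE /= rmorph_sum.
by apply: eq_bigr => j _; rewrite !ffunE /= rmorphM mulrC.
Qed.

(** The diagonal entries of [tctr A *e A] are sums of squared moduli over the columns of [A], and
    such a sum vanishes only termwise. *)
Lemma tctr_mul_eq0 I J (A : tensor R I J) : tctr A *e A = 0 -> A = 0.
Proof.
move=> /ffunP A0; apply/ffunP => -[i j]; rewrite ffunE.
have /eqP := A0 (j, j); rewrite !ffunE /= psumr_eq0 => [/allP/(_ i)|k _];
  rewrite ?ffunE mulrC; last exact: mul_conjC_ge0.
by rewrite mem_index_enum mul_conjC_eq0 => /(_ isT)/eqP.
Qed.

(** For D = A (B - C) the hypothesis yields D^* D = 0, hence D = 0. *)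
Lemma tctr_mulI I J K (A : tensor R I J) (B C : tensor R J K) :
  tctr A *e A *e B = tctr A *e A *e C -> A *e B = A *e C.
Proof.
move=> eqBC; apply/subr0_eq; rewrite -einsteinBr; apply: tctr_mul_eq0.
by rewrite tctrM einsteinA -(einsteinA _ (tctr A)) -einsteinA einsteinBr eqBC
  subrr; apply/ffunP => x; rewrite !ffunE big1 // => y _; rewrite !ffunE mulr0.
Qed.

Lemma mul_tctrI I J K (A : tensor R J K) (B C : tensor R I J) :
  B *e A *e tctr A = C *e A *e tctr A -> B *e A = C *e A.
Proof.
move=> eqBC; rewrite -[LHS]tctrK -[RHS]tctrK !(tctrM _ A); congr tctr.
by apply: tctr_mulI; rewrite tctrK -{1 3}(tctrK A) -!tctrM !einsteinA eqBC.
Qed.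

(** Enumerating the multi-indices turns [*e] into [*m], so that matrix rank and [pinvmx] become
    available for tensors. *)
Definition tensor_mx I J (A : tensor R I J) : 'M[R[i]]_(#|{: midx I}|, #|{: midx J}|) :=
  \matrix_(i, j) A (enum_val i, enum_val j).

Definition mx_tensor I J (M : 'M[R[i]]_(#|{: midx I}|, #|{: midx J}|)) : tensor R I J :=
  [ffun ij => M (enum_rank ij.1) (enum_rank ij.2)].

Lemma tensor_mxK I J : cancel (@tensor_mx I J) (@mx_tensor I J).
Proof. by move=> A; apply/ffunP => -[i j]; rewrite !ffunE mxE !enum_rankK. Qed.

Lemma mx_tensorK I J : cancel (@mx_tensor I J) (@tensor_mx I J).
Proof. by move=> M; apply/matrixP => i j; rewrite mxE ffunE !enum_valK. Qed.

Lemma tensor_mxM I J K (A : tensor R I J) (B : tensor R J K) :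
  tensor_mx (A *e B) = tensor_mx A *m tensor_mx B.
Proof.
apply/matrixP => i k; rewrite !mxE ffunE /= (reindex (@enum_val (midx J) {: midx J})) /=.
  by apply: eq_bigr => j _; rewrite !mxE.
by apply: onW_bij; exact: enum_val_bij.
Qed.

Lemma ginv_exists I J (A : tensor R I J) :
  exists G : tensor R J I, A *e G *e A = A.
Proof.
(* [pinvmx] comes from Gaussian elimination and is in general not the Moore-Penrose inverse. *)
exists (mx_tensor (pinvmx (tensor_mx A))).
apply: (can_inj (@tensor_mxK I J)).
by rewrite !tensor_mxM mx_tensorK mulmxKpV.
Qed.

(* Q = T P makes the row space of Q a subspace of that of P; P = Q W forces the
   ranks to agree. *)
Lemma mul_left_of_right I J (P Q : tensor R I J) W T :
  P = Q *e W -> Q = T *e P -> exists V, P = V *e Q.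
Proof.
move=> PQ QP; suff /submxP[V PV] : (tensor_mx P <= tensor_mx Q)%MS.
  exists (mx_tensor V); apply: (can_inj (@tensor_mxK I J)).
  by rewrite tensor_mxM mx_tensorK.
have sQP : (tensor_mx Q <= tensor_mx P)%MS.
  by rewrite QP tensor_mxM submxMl.
by rewrite -(geq_leqif (mxrank_leqif_sup sQP)) {1}PQ tensor_mxM mxrankM_maxl.
Qed.

(** Each column of [P] is the image of a unit vector, so it has a preimage under [Q]; these
    preimages are the columns of [W]. *)
Lemma trange_sub_factor I J K (P : tensor R I J) (Q : tensor R I K) :
  (trange P `<=` trange Q)%classic -> exists W, P = Q *e W.
Proof.
move=> sPQ.
have /choice[w wP] (j : midx J) : exists X, tapply Q X = [ffun i => P (i, j)].
  suff /sPQ[X _ <-] : trange P [ffun i => P (i, j)] by exists X.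
  exists [ffun l => (l == j)%:R] => //; apply/ffunP => i.
  rewrite !ffunE (bigD1 j) //= ffunE eqxx mulr1 big1 ?addr0 // => l.
  by rewrite ffunE => /negPf ->; rewrite mulr0.
exists [ffun kj => w kj.2 kj.1]; apply/ffunP => -[i j].
have /ffunP/(_ i) := wP j; rewrite !ffunE => <-.
by apply: eq_bigr => k _; rewrite ffunE.
Qed.

Lemma reflexive_ginv_exists I J (A : tensor R I J) :
  exists G : tensor R J I, A *e G *e A = A /\ G *e A *e G = G.
Proof.
have [G AGA] := ginv_exists A; exists (G *e A *e G).
have AGAr K (B : tensor R J K) : A *e (G *e (A *e B)) = A *e B.
  by rewrite !einsteinA AGA.
by split; rewrite -!einsteinA !AGAr // einsteinA.
Qed.

Lemma mp_exists I J (A : tensor R I J) : exists X, is_mp A X.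
Proof.
pose S := tctr A; pose M := S *e A *e S.
have [G [MGM GMG]] := reflexive_ginv_exists M.
(* The leading factor of M G M = M is M = S A S; cancelling first S, then A, leaves S G M = S. [MGS]
   is the mirror image. *)
have SGM : S *e G *e M = S.
  rewrite -[RHS]einsteint1 -einsteinA; apply: tctr_mulI.
  rewrite tctrK einsteint1 -einsteinA; apply: tctr_mulI.
  by rewrite -/S -[RHS]MGM /M !einsteinA.
have MGS : M *e G *e S = S.
  rewrite -[RHS]einstein1t; apply: mul_tctrI; rewrite tctrK einstein1t.
  by apply: mul_tctrI; rewrite -/S -[RHS]MGM /M !einsteinA.
exists (S *e G *e S).
have SP : S *e (A *e (S *e G *e S)) = S by rewrite -[RHS]MGS /M !einsteinA.
have QS : S *e G *e S *e A *e S = S by rewrite -[RHS]SGM /M !einsteinA.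
(* For X = S G S, [PA] and [AQ] are the conjugate transposes of S A X = S and X A S = S. *)
have PA : tctr (A *e (S *e G *e S)) *e A = A.
  by rewrite -[RHS]tctrK -/S -[X in _ = tctr X]SP [RHS]tctrM tctrK.
have AQ : A *e tctr (S *e G *e S *e A) = A.
  by rewrite -[RHS]tctrK -/S -[X in _ = tctr X]QS [RHS]tctrM tctrK.
split.
- rewrite -[RHS]einstein1t; apply: mul_tctrI.
  by rewrite einstein1t -/S -[in RHS]QS !einsteinA.
(* Here reflexivity of G enters: X A X = S (G M G) S. *)
- by rewrite -[in RHS]GMG /M !einsteinA.
(* P = A X satisfies P^* P = P, so it is Hermitian; likewise for X A below. *)
- have PP : tctr (A *e (S *e G *e S)) *e (A *e (S *e G *e S)) =
            A *e (S *e G *e S) by rewrite {1}einsteinA PA.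
  by rewrite -{1}PP tctrM tctrK.
- have QQ : S *e G *e S *e A *e tctr (S *e G *e S *e A) = S *e G *e S *e A.
    by rewrite -{1}einsteinA AQ.
  by rewrite -{1}QQ tctrM tctrK.
Qed.

End EinsteinProduct.

Section Drazin.
Variables (R : realType) (N : nat) (I : 'I_N -> nat).
Implicit Types A B G X Y : tensor R I I.

Lemma tpowD A m n : tpow A (m + n) = tpow A m *e tpow A n.
Proof. by elim: m => [|m IH]; rewrite ?einstein1t //= IH einsteinA. Qed.

Lemma tpowSr A n : tpow A n.+1 = tpow A n *e A.
Proof. by rewrite -addn1 tpowD /= einsteint1. Qed.

Lemma tpow_comm A X n : A *e X = X *e A -> tpow A n *e X = X *e tpow A n.
Proof.
move=> AX; elim: n => [|n IH]; first by rewrite einstein1t einsteint1.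
by rewrite /= -einsteinA IH !einsteinA AX.
Qed.

Lemma tindexP A : trange (tpow A (tindex A)) = trange (tpow A (tindex A).+1).
Proof. by rewrite /tindex; case: ex_minnP => k /asboolP. Qed.

(** Stable ranges give A^k = A^(k+1) U; substituting this into itself raises the exponent one step
    at a time. *)
Lemma tpow_tindex_right A n :
  exists W, tpow A (tindex A) = tpow A (tindex A + n) *e W.
Proof.
have [U AU] : exists U, tpow A (tindex A) = tpow A (tindex A).+1 *e U.
  by apply: trange_sub_factor; rewrite tindexP.
elim: n => [|n [W AW]]; first by exists (tid R I); rewrite addn0 einsteint1.
exists (U *e W); rewrite -addSnnS addnC tpowD -einsteinA (einsteinA _ U) -AU.
by rewrite einsteinA -tpowD addnC.
Qed.

(** The index speaks of ranges, hence of right factors; the left factor comes from equality of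
    ranks. *)
Lemma tpow_tindex_left A n :
  exists V, tpow A (tindex A) = V *e tpow A (tindex A + n).
Proof.
have [W AW] := tpow_tindex_right A n.
by apply: (mul_left_of_right AW); rewrite addnC; exact: tpowD.
Qed.

Lemma is_drazin_ginv A G (k := tindex A) (B := tpow A (k + k.+1)) :
  B *e G *e B = B -> is_drazin A (tpow A k *e G *e tpow A k).
Proof.
move=> BGB; have [W AW] := tpow_tindex_right A k.+1.
have [V VA] := tpow_tindex_left A k.+1; rewrite -/k -/B in AW VA.
set X := _ *e G *e _.
(* X = V (B G B) W = V B W, which is read as A^k W here and as V A^k in [XV]. *)
have XW : X = tpow A k *e W.
  by rewrite /X {1 3}VA AW -[in RHS]BGB !einsteinA.
have XV : X = V *e tpow A k.
  by rewrite /X {1}VA AW -[in RHS]BGB !einsteinA.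
(* The exponent 2k+1 is chosen for this: A^(k+1) A^k = B. *)
have AkX : tpow A k.+1 *e X = tpow A k.
  by rewrite XW einsteinA -tpowD addnC -AW.
have XAk : X *e tpow A k.+1 = tpow A k.
  by rewrite XV -einsteinA -tpowD -VA.
have AX : A *e X = X *e A.
  (* X A = V A A^k = V A B W = V B A W = A^k A W = A X. *)
  have BA : A *e B = B *e A by rewrite tpow_comm.
  rewrite {1}XW XV -einsteinA -tpowSr [tpow A k.+1]/= {2}AW !einsteinA.
  by rewrite -(einsteinA V) BA einsteinA -VA -tpowSr.
split; rewrite -/k //.
by rewrite XW -{1}XW -einsteinA (einsteinA A) einsteinA XAk.
Qed.

(** A X is idempotent with commuting factors, so A X = (A X)^n = A^n X^n for n > 0. This exposes a
    power of A on which the Drazin equation of another inverse can act. *)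
Lemma outer_inverse_tpowl A X n : A *e X = X *e A -> X *e A *e X = X ->
  exists Z, A *e X = tpow A n *e Z.
Proof.
move=> AX XAX; elim: n => [|n [Z AZ]].
  by exists (A *e X); rewrite einstein1t.
by exists (Z *e X); rewrite -{1}XAX -AX AZ !einsteinA.
Qed.

Lemma outer_inverse_tpowr A X n : A *e X = X *e A -> X *e A *e X = X ->
  exists Z, A *e X = Z *e tpow A n.
Proof.
move=> AX XAX; elim: n => [|n [Z AZ]].
  by exists (A *e X); rewrite einsteint1.
by exists (X *e Z); rewrite AX -{1}XAX -(einsteinA X) AZ -!einsteinA -tpowSr.
Qed.

(* The idempotents A X and A Y absorb each other, hence coincide. *)
Lemma drazin_unique A X Y : is_drazin A X -> is_drazin A Y -> X = Y.
Proof.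
set k := tindex A; move: X Y.
have key X Y : is_drazin A X -> is_drazin A Y ->
    A *e X = A *e Y *e (A *e X) /\ A *e X = A *e X *e (A *e Y).
  move=> [_ XAX AX] [AkY _ AY]; split.
    (* The power k+1 is absorbed by A Y: A Y A^(k+1) = A A^(k+1) Y = A^(k+1). *)
    have [Z ->] := outer_inverse_tpowl k.+1 AX XAX.
    by rewrite einsteinA -(einsteinA A) -(tpow_comm _ AY) AkY.
  have [Z ->] := outer_inverse_tpowr k.+1 AX XAX.
  by rewrite AY -einsteinA (einsteinA _ Y) AkY -tpowSr.
move=> X Y dX dY; have [[_ XAX AX] [_ YAY AY]] := (dX, dY).
have AXY : A *e X = A *e Y.
  have [EFE _] := key _ _ dX dY; have [_ FFE] := key _ _ dY dX.
  by rewrite EFE -FFE.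
by rewrite -XAX -einsteinA AXY einsteinA -AX AXY AY YAY.
Qed.

End Drazin.

Theorem theorem3p18 (R : realType) (N : nat) (I : 'I_N -> nat)
    (N_gt0 : (0 < N)%N) (I_gt0 : forall s : 'I_N, (0 < I s)%N)
    (A : tensor R I I) (k : nat) (indA : tindex A = k) :
  drazin A = tpow A k *e mpinv (tpow A (2 * k + 1)%N) *e tpow A k.
Proof.
(* Existence rules out the default 0 of [xget], so [mpinv] satisfies the Penrose equations. *)
have /xgetPex-/(_ 0)[BGB _ _ _] := mp_exists (tpow A (2 * k + 1)).
have dX : is_drazin A (tpow A k *e mpinv (tpow A (2 * k + 1)) *e tpow A k).
  by move: BGB; rewrite -indA mul2n -addnn -addnA addn1; exact: is_drazin_ginv.
by apply: xget_unique => // Y dY; exact: drazin_unique dY dX.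
Qed.
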